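(* Let $k=2K+1$ be an odd integer, and let $\mathcal{B}_K^{(1)}$ be the $(K-1)\times(K-1)$ submatrix of $\mathcal{B}_K$ obtained by deleting the last column and the last row of $\mathcal{B}_K$. Then the vectors formed by the coefficients of $Z_{r,s}$ in the weight-$k$ Type I and Type II relations belong to the left kernel of $\mathcal{B}_K^{(1)}$. Explicitly: (Type I) if $2K\ge 12$ and $p\in W_{2K}^+$, with $b_{r,s}$ ($r+s=2K+1$, $r,s\ge1$) defined by $p(X+Y,Y)=\sum_{r+s=2K+1}\binom{2K-1}{r-1}b_{r,s}X^{r-1}Y^{s-2}$ (so $b_{2K,1}=0$), then the row vector $v=(v_1,\dots,v_{K-1})$ with $v_1=0$ and $v_i=b_{2i,\,k-2i}-b_{k-2i,\,2i}$ for $2\le i\le K-1$ satisfies $v\,\mathcal{B}_K^{(1)}=0$; (Type II) if $2K+2\ge 12$ and $p\in W_{2K+2}^-$, with $c_{r,s}$ ($r+s=2K+1$, $r,s\ge1$) defined by $\frac{\partial}{\partial X}p(X+Y,Y)=\sum_{r+s=2K+1}\binom{2K-1}{r-1}c_{r,s}X^{r-1}Y^{s-1}$, then the row vector $v=(v_1,\dots,v_{K-1})$ with $v_1=0$ and $v_i=c_{2i,\,k-2i}-c_{k-2i,\,2i}$ for $2\le i\le K-1$ satisfies $v\,\mathcal{B}_K^{(1)}=0$.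
   Context: The matrix $\mathcal{B}_K$. For $k=2K+1$, Zagier's formula states, for $0\le m\le K-1$, $$\zeta(k-2m-1,2m+1)=\sum_{n=1}^K\left[\delta_{n,m}+\delta_{n,K}-\binom{2n}{2m}-\binom{2n}{2K-2m-1}\right]\zeta(2n+1)\zeta(k-2n-1),$$ with the convention $\zeta(0)=-\tfrac12$, where $\zeta(r,s)=\sum_{a>b>0}a^{-r}b^{-s}$ and $\delta$ is the Kronecker delta. $\mathcal{B}_K$ is the $K\times K$ matrix expressing the column vector $(\zeta(2,k-2),\zeta(4,k-4),\dots,\zeta(2K,1))^T$ in terms of the column vector $(\zeta(k-3)\zeta(3),\zeta(k-5)\zeta(5),\dots,\zeta(2)\zeta(k-2),\zeta(k))^T$ via this formula: row $i$ ($1\le i\le K$) corresponds to $\zeta(2i,k-2i)$, i.e. $m=K-i$; column $n$ ($1\le n\le K-1$) corresponds to $\zeta(2n+1)\zeta(k-2n-1)$; the last column $n=K$ corresponds to $\zeta(k)$ (the factor $\zeta(0)=-\frac12$ being absorbed into the entries). Hence the entries of $\mathcal{B}_K^{(1)}$ are, for $1\le i,n\le K-1$, $$(\mathcal{B}_K^{(1)})_{i,n}=\delta_{n,K-i}-\binom{2n}{2K-2i}-\binom{2n}{2i-1}.$$ Binomial coefficients $\binom{a}{b}$ with $b>a\ge0$ are $0$. The left kernel of a matrix $M$ is the space of row vectors $v$ with $vM=0$. The Type I and Type II relations of weight $k$ are the relations $\sum (b_{r,s}-b_{s,r})Z_{r,s}\equiv 0$ and $\sum(c_{r,s}-c_{s,r})Z_{r,s}\equiv0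 \pmod {Z_k}$, summed over even $r$ with $4\le r\le k-3$ and $s=k-r$, in the formal double zeta space of weight $k$ (with formal symbols $Z_{r,s}$ corresponding to $\zeta(r,s)$); only their coefficients matter here. Period polynomials. For even $w$, $W_w$ is the space of homogeneous polynomials $P\in\mathbb{Q}[X,Y]$ of degree $w-2$ satisfying $P(X,Y)+P(-Y,X)=0$ and $P(X,Y)+P(X-Y,X)+P(Y,Y-X)=0$; $W_w^+$ (resp. $W_w^-$) is the subspace of those that are symmetric, $P(X,Y)=P(Y,X)$ (resp. antisymmetric, $P(X,Y)=-P(Y,X)$). *)

(* Defs.v *)
From mathcomp Require Import all_boot all_order all_algebra.
From mathcomp Require Import mpoly.

Set Implicit Arguments.
Unset Strict Implicit.
Unset Printing Implicit Defensive.

Import GRing.Theory.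
Local Open Scope ring_scope.

Definition X : {mpoly rat[2]} := 'X_0.
Definition Y : {mpoly rat[2]} := 'X_1.

(* subst2 P A B is P(A, B). *)
Definition subst2 (P A B : {mpoly rat[2]}) : {mpoly rat[2]} :=
  P \mPo [tuple A; B].

Definition period_poly (w : nat) (P : {mpoly rat[2]}) : Prop :=
  [/\ P \is (w - 2).-homog,
      P + subst2 P (- Y) X = 0
    & P + subst2 P (X - Y) X + subst2 P Y (Y - X) = 0].

Definition sym_period_poly (w : nat) (P : {mpoly rat[2]}) : Prop :=
  period_poly w P /\ P = subst2 P Y X.

Definition antisym_period_poly (w : nat) (P : {mpoly rat[2]}) : Prop :=
  period_poly w P /\ P = - subst2 P Y X.

(* Coefficient of zeta(2n+1) zeta(k-2n-1) in Zagier's formula for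
   zeta(k-2m-1, 2m+1), where k = 2K+1, 0 <= m <= K-1 and 1 <= n <= K. *)
Definition zagier_coef (K m n : nat) : rat :=
  (n == m)%:R + (n == K)%:R - 'C(2 * n, 2 * m)%:R
  - 'C(2 * n, 2 * K - 2 * m - 1)%:R.

(* The ordinals i, n are 0-based: row i is the row of index i+1, which expresses
   zeta(2(i+1), k-2(i+1)), so m = K-(i+1); column n is the column of index n+1.
   In the last column zeta(2K+1) zeta(0) = - zeta(k)/2. *)
Definition zagier_mx (K : nat) : 'M[rat]_K :=
  \matrix_(i < K, n < K)
    (zagier_coef K (K - i.+1) n.+1 * (if n.+1 == K then - 2^-1 else 1)).

Definition zagier_mx1 (K : nat) : 'M[rat]_(K.-1) :=
  mxsub (widen_ord (leq_pred K)) (widen_ord (leq_pred K)) (zagier_mx K).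

(* b_{r,s} for r + s = 2K+1, r, s >= 1, read off from p(X+Y, Y).  The term
   (r, s) = (2K, 1) carries the exponent s-2 = -1 of Y; its coefficient b_{2K,1}
   is 0, so the truncated exponent in that term is irrelevant. *)
Definition typeI_coefs (K : nat) (p : {mpoly rat[2]}) (b : nat -> nat -> rat)
    : Prop :=
  b (2 * K)%N 1%N = 0 /\
  subst2 p (X + Y) Y =
    \sum_(1 <= r < (2 * K).+1)
      let s := (2 * K + 1 - r)%N in
      ('C(2 * K - 1, r - 1)%:R * b r s) *: (X ^+ (r - 1) * Y ^+ (s - 2)).

Definition typeII_coefs (K : nat) (p : {mpoly rat[2]}) (c : nat -> nat -> rat)
    : Prop :=
  mderiv 0 (subst2 p (X + Y) Y) =
    \sum_(1 <= r < (2 * K).+1)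
      let s := (2 * K + 1 - r)%N in
      ('C(2 * K - 1, r - 1)%:R * c r s) *: (X ^+ (r - 1) * Y ^+ (s - 1)).

(* The coefficient of Z_{2i,k-2i}, 1 <= i <= K-1, in the relation
   sum (a_{r,s} - a_{s,r}) Z_{r,s} = 0 over even r with 4 <= r <= k-3 and s = k-r,
   where k = 2K+1; the 0-based index j stands for i = j+1. *)
Definition relation_row (K : nat) (a : nat -> nat -> rat) : 'rV[rat]_(K.-1) :=
  \row_(j < K.-1)
    let r := (2 * j.+1)%N in
    let s := (2 * K + 1 - r)%N in
    if (4 <= r)%N then a r s - a s r else 0.

(* Main.v *)
(* Let N = 2K-1.  Both types of coefficients come from a binary form
   f(u,v) = sum_j C(N,j) a_j u^j v^(N-j), namely v p(u+v,v) (Type I) or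
   (d_1 p)(u+v,v) (Type II), and the relation vector collects the odd-indexed
   terms of w_j = a_j - a_(N-j), whose form is g(u,v) = f(u,v) - f(v,u).  In
   both cases the period relations give g(x,1) = g(-x,1+x) and g(0,1) = 0.
   The first identity says that w is its own binomial transform:
   w_l = sum_i (-1)^i C(l,i) w_i.  Splitting this sum at l = 2n by the parity
   of i, and using w_(N-j) = -w_j and w_0 = 0 to turn the even-indexed terms
   into odd-indexed ones, gives column n of the kernel equation; l = 1 gives
   w_1 = 0, which is why the relation has no term in Z_(2,k-2). *)
From HB Require Import structures.
Require Import Defs.
From mathcomp Require Import all_boot all_order all_algebra.
From mathcomp Require Import mpoly.
From mathcomp Require Import ring zify.

Import GRing.Theory Num.Theory.
Local Open Scope ring_scope.

(** * Evaluation in [{poly rat}] and the chain rule *)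

Definition eval2 (u v : {poly rat}) (P : {mpoly rat[2]}) : {poly rat} :=
  mmap polyC (tnth [tuple u; v]) P.

HB.instance Definition _ u v :=
  GRing.RMorphism.copy (eval2 u v) (mmap polyC (tnth [tuple u; v])).

Lemma eval2D u v P Q : eval2 u v (P + Q) = eval2 u v P + eval2 u v Q.
Proof. exact: raddfD. Qed.

Lemma eval2N u v P : eval2 u v (- P) = - eval2 u v P.
Proof. exact: raddfN. Qed.

Lemma eval2M u v P Q : eval2 u v (P * Q) = eval2 u v P * eval2 u v Q.
Proof. exact: rmorphM. Qed.

Lemma eval2Z u v (c : rat) P : eval2 u v (c *: P) = c *: eval2 u v P.
Proof. by rewrite /eval2 mmapZ mul_polyC. Qed.

Lemma eval2XY u v : (eval2 u v X = u) * (eval2 u v Y = v).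
Proof. by rewrite /eval2 !mmapX !mmap1U. Qed.

Lemma eval2_subst2 u v P A B :
  eval2 u v (subst2 P A B) = eval2 (eval2 u v A) (eval2 u v B) P.
Proof.
rewrite /subst2 comp_mpolyE raddf_sum /= [RHS]/mmap.
apply: eq_bigr => m _; rewrite eval2Z -mul_polyC; congr (_ * _).
rewrite rmorph_prod; apply: eq_bigr => i _ /=.
rewrite rmorphXn; congr (_ ^+ _).
by case: i => [[|[|//]] ?]; rewrite !(tnth_nth 0).
Qed.

Definition eval2E := (eval2D, eval2N, eval2M, eval2XY, eval2_subst2).

Lemma subst2D P Q A B : subst2 (P + Q) A B = subst2 P A B + subst2 Q A B.
Proof. exact: raddfD. Qed.

Lemma subst2M P Q A B : subst2 (P * Q) A B = subst2 P A B * subst2 Q A B.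
Proof. exact: rmorphM. Qed.

Lemma mderivU (j l : 'I_2) : mderiv j ('X_l : {mpoly rat[2]}) = (j == l)%:R.
Proof.
rewrite mderivX mnm1E eq_sym; case: eqVneq => [->|_]; last by rewrite scale0r.
rewrite (_ : U_(l) - U_(l) = 0)%MM ?scale1r ?mpolyX0 //.
by apply/mnmP => i; rewrite mnmBE subnn mnm0E.
Qed.

(** By the Leibniz rule the identity is closed under products, and it is linear in [P]; so it passes
    from the variables to monomials and then to all polynomials. *)
Lemma mderiv_subst2 i P A B :
  mderiv i (subst2 P A B) =
  subst2 (mderiv 0 P) A B * mderiv i A + subst2 (mderiv 1 P) A B * mderiv i B.
Proof.
pose chain P := mderiv i (subst2 P A B) = subst2 (mderiv 0 P) A B * mderiv i A
  + subst2 (mderiv 1 P) A B * mderiv i B.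
have chainM Q R : chain Q -> chain R -> chain (Q * R).
  rewrite /chain subst2M !mderivM => -> ->.
  (* With the substitutions visible, [ring] compares them up to conversion
     and does not terminate in practice. *)
  rewrite !subst2D !subst2M; do !move: (subst2 _ A B).
  by move: (mderiv i A) (mderiv i B) => dA dB q q0 q1 r r0 r1; ring.
have chain1 : chain 1.
  by rewrite /chain /subst2 rmorph1 -mpolyC1 !mderivC rmorph0 !mul0r addr0.
have chainU (j : 'I_2) : chain 'X_j.
  rewrite /chain !mderivU /subst2 comp_mpolyXU.
  by case: j => [[|[|//]] ?];
    rewrite !(rmorph1, rmorph0) mul1r mul0r ?addr0 ?add0r.
elim/mpolyind: P => [|c m P _ _ IH].
  by rewrite /subst2 !(raddf0, mul0r, addr0).
have chainX : chain 'X_[m].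
  rewrite mpolyXE_id; apply: (big_ind chain chain1 chainM) => j _.
  elim: (m j) => [|k IHk]; first exact: chain1.
  by rewrite exprS; exact: chainM (chainU j) IHk.
rewrite /subst2 !linearP /= -!/(subst2 _ _ _) IH chainX.
by rewrite !mulrDl -!scalerAl scalerDr addrACA.
Qed.

Lemma mderivXY :
  (mderiv 0 X = 1) * (mderiv 1 X = 0) * (mderiv 0 Y = 0) * (mderiv 1 Y = 1).
Proof. by rewrite /X /Y !mderivU. Qed.

(** * Binary forms and the binomial transform *)

Lemma mul_bin_trinomial N l i : (i <= l <= N)%N ->
  ('C(N, i) * 'C(N - i, l - i) = 'C(N, l) * 'C(l, i))%N.
Proof.
case/andP=> il lN.
have iN := leq_trans il lN.
have e1 := bin_fact iN; have e2 := bin_fact lN; have e3 := bin_fact il.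
have e4 := bin_fact (leq_sub2r i lN).
have e5 : (N - i - (l - i) = N - l)%N by lia.
rewrite e5 in e4.
apply/eqP; rewrite -(eqn_pmul2r (fact_gt0 i)) -(eqn_pmul2r (fact_gt0 (l - i))).
rewrite -(eqn_pmul2r (fact_gt0 (N - l))); apply/eqP.
transitivity N`!; first by rewrite -e1 -e4; ring.
by rewrite -e2 -e3; ring.
Qed.

Definition binary_form (N : nat) (w : nat -> rat) (u v : {poly rat}) :
    {poly rat} :=
  \sum_(j < N.+1) ('C(N, j)%:R * w j) *: (u ^+ j * v ^+ (N - j)).

Lemma binary_formB N w w' u v :
  binary_form N (fun j => w j - w' j) u v =
  binary_form N w u v - binary_form N w' u v.
Proof. by rewrite -sumrB; apply: eq_bigr => j _; rewrite mulrBr scalerBl. Qed.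

Lemma binary_form_rev N w u v :
  binary_form N (fun j => w (N - j)%N) u v = binary_form N w v u.
Proof.
rewrite /binary_form (reindex_inj rev_ord_inj) /=; apply: eq_bigr => j _.
have jN : (j <= N)%N by rewrite -ltnS.
by rewrite subSS bin_sub // subKn // [X in _ *: X]mulrC.
Qed.

Lemma binary_form01 N w : binary_form N w 0 1 = (w 0%N)%:P.
Proof.
rewrite /binary_form big_ord_recl big1 ?addr0 => [|j _].
  by rewrite bin0 mul1r expr0 expr1n mulr1 alg_polyC.
by rewrite expr0n mul0r scaler0.
Qed.

Lemma coef_exprD1X n m : ((1 + 'X) ^+ n : {poly rat})`_m = 'C(n, m)%:R.
Proof.
rewrite exprDn coef_sum.
under eq_bigr => i _ do rewrite expr1n mul1r coefMn coefXn.
have [mn|nm] := leqP m n.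
  rewrite (bigD1 (Ordinal (mn : (m < n.+1)%N))) //= eqxx big1 ?addr0 // => i im.
  rewrite (_ : (m == i) = false) ?mul0rn //.
  by apply: contraNF im => /eqP mi; apply/eqP/val_inj.
rewrite bin_small // big1 // => i _.
by rewrite (_ : (m == i) = false) ?mul0rn //; have := ltn_ord i; lia.
Qed.

(** The coefficient of X^l in (-X)^j (1+X)^(N-j) is (-1)^j C(N-j,l-j). Since C(N,j) C(N-j,l-j) =
    C(N,l) C(l,j), comparing coefficients of X^l and cancelling C(N,l) gives the transform. *)
Lemma binomial_self_inverse N w l :
    binary_form N w 'X 1 = binary_form N w (- 'X) (1 + 'X) -> (l <= N)%N ->
  w l = \sum_(i < l.+1) (-1) ^+ i * 'C(l, i)%:R * w i.
Proof.
move=> /(congr1 (coefp l)) /= eqw lN.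
have CNl : 'C(N, l)%:R != 0 :> rat by rewrite pnatr_eq0 -lt0n bin_gt0.
apply: (mulfI CNl).
transitivity (binary_form N w 'X 1)`_l.
  rewrite coef_sum (bigD1 (Ordinal (lN : (l < N.+1)%N))) //= big1 => [|j jl].
    by rewrite addr0 coefZ expr1n mulr1 coefXn eqxx mulr1.
  rewrite coefZ expr1n mulr1 coefXn (_ : (l == j) = false) ?mulr0 //.
  by apply: contraNF jl => /eqP lj; apply/eqP/val_inj.
rewrite eqw coef_sum mulr_sumr.
(* The sum over i <= l is padded to i <= N; on the other side the terms with j > l vanish because
   X^j divides them. *)
pose F i := 'C(N, l)%:R * ((-1) ^+ i * 'C(l, i)%:R * w i).
rewrite (big_ord_widen N.+1 F) // /F.
rewrite [RHS]big_mkcond; apply: eq_bigr => j _.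
rewrite coefZ (exprNn 'X) -(mulrA _ ('X^j)) -(rmorph_sign (@polyC rat)).
rewrite coefCM coefXnM ltnS ltnNge.
have [jl|lj] := leqP j l; last by rewrite !mulr0.
have jlN : (j <= l <= N)%N by rewrite jl.
have := congr1 (fun m => m%:R : rat) (mul_bin_trinomial _ _ _ jlN).
by rewrite coef_exprD1X /= !natrM => e; ring: e.
Qed.

(** * Parity splitting and the kernel equation *)

Lemma big_ord_even_odd (n : nat) (F : nat -> rat) :
  \sum_(i < n.*2) F i = \sum_(i < n) (F i.*2 + F i.*2.+1).
Proof.
elim: n => [|n IHn]; first by rewrite !big_ord0.
by rewrite doubleS !big_ord_recr /= IHn addrA.
Qed.

Lemma self_inverse_kernel L (w : nat -> rat) (n : nat) :
    (forall j, j <= L.*2.+1 -> w (L.*2.+1 - j) = - w j)%N -> w 0%N = 0 ->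
    (forall l, (l <= L.*2.+1)%N ->
       w l = \sum_(i < l.+1) (-1) ^+ i * 'C(l, i)%:R * w i) ->
    (n < L)%N ->
  \sum_(i < L) w i.*2.+1 * ((n.+1 == L - i)%N%:R
     - 'C(n.+1.*2, (L - i).*2)%:R - 'C(n.+1.*2, i.*2.+1)%:R) = 0.
Proof.
move=> wN w0 w_inv nL.
have wL : w L.*2.+1 = 0 by rewrite -[X in w X]subn0 wN // w0 oppr0.
pose c i : rat := 'C(n.+1.*2, i)%:R.
(* The delta selects i = L-n-1, and 2i+1 = (2L+1) - 2(n+1), so antisymmetry of [w] applies. *)
have diag : \sum_(i < L) w i.*2.+1 * (n.+1 == L - i)%N%:R = - w n.+1.*2.
  have iL : (L - n.+1 < L)%N by lia.
  rewrite (bigD1 (Ordinal iL)) //= big1 ?addr0 => [|i ni].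
    rewrite subKn // eqxx mulr1 -wN; last by lia.
    by congr w; lia.
  rewrite (_ : (n.+1 == L - i)%N = false) ?mulr0 //.
  apply: contraNF ni => /eqP e; apply/eqP/val_inj => /=.
  by have := ltn_ord i; lia.
(* Reversing i turns the index 2i+1 into (2L+1) - 2(i+1); the added term at index 0 vanishes with
   [w 0]. *)
have evens :
    \sum_(i < L) w i.*2.+1 * c (L - i).*2 = - \sum_(i < L.+1) w i.*2 * c i.*2.
  rewrite big_ord_recl w0 mul0r add0r (reindex_inj rev_ord_inj) -sumrN /=.
  apply: eq_bigr => i _; have iL := ltn_ord i.
  rewrite subKn // -mulNr -wN; last by rewrite /bump; lia.
  by congr (w _ * c _); rewrite /bump; lia.
have odds :
    \sum_(i < L) w i.*2.+1 * c i.*2.+1 = \sum_(i < L.+1) w i.*2.+1 * c i.*2.+1.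
  by rewrite [RHS]big_ord_recr /= wL mul0r addr0.
have parity :
    w n.+1.*2 = \sum_(i < L.+1) (w i.*2 * c i.*2 - w i.*2.+1 * c i.*2.+1).
  rewrite w_inv; last by lia.
  pose F i := (-1) ^+ i * c i * w i.
  (* Binomials above the diagonal are 0, so the range can be padded to an even length before
     pairing. *)
  transitivity (\sum_(i < L.+1.*2) F i).
    rewrite [LHS](big_ord_widen L.+1.*2 F); last by lia.
    rewrite big_mkcond; apply: eq_bigr => i _.
    by case: ifPn => // ni; rewrite /F /c bin_small ?mulr0 ?mul0r //; lia.
  rewrite big_ord_even_odd; apply: eq_bigr => i _.
  by rewrite /F -signr_odd -[_ ^+ _.+1]signr_odd /= odd_double; ring.
under eq_bigr do rewrite !mulrBr.
by rewrite !sumrB diag evens odds parity sumrB opprB opprK; ring.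
Qed.

Lemma relation_row_kernel K (a : nat -> nat -> rat)
    (f := binary_form (2 * K - 1) (fun j => a j.+1 (2 * K - j)%N)) :
    f 0 1 = f 1 0 ->
    f 'X 1 - f 1 'X = f (- 'X) (1 + 'X) - f (1 + 'X) (- 'X) ->
  relation_row K a *m zagier_mx1 K = 0.
Proof.
case: K @f => [|L]; first by move=> _ _ _; apply/matrixP => i [].
set N := (2 * L.+1 - 1)%N => f f01 fX.
have NE : N = L.*2.+1 by rewrite /N; lia.
pose w0 j := a j.+1 (2 * L.+1 - j)%N.
pose w j : rat := w0 j - w0 (N - j)%N.
have fB u v : binary_form N w u v = f u v - f v u.
  by rewrite binary_formB (binary_form_rev N w0).
have wN j : (j <= N)%N -> w (N - j)%N = - w j.
  by move=> jN; rewrite /w opprB subKn.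
have w00 : w 0%N = 0.
  by apply/polyC_inj; rewrite -(binary_form01 N) fB f01 subrr.
have w_inv l : (l <= N)%N ->
    w l = \sum_(i < l.+1) (-1) ^+ i * 'C(l, i)%:R * w i.
  by apply: binomial_self_inverse; rewrite !fB fX.
have w1 : w 1%N = 0.
  have := w_inv 1%N; rewrite NE => /(_ isT).
  rewrite !big_ord_recl big_ord0 /= w00 /bump /= mulr0 add0r addr0 mulr1 mulN1r.
  by move/eqP; rewrite -subr_eq0 opprK -mulr2n mulrn_eq0 => /eqP.
apply/matrixP => i n; rewrite ord1 !mxE.
have nL : (n < L)%N := ltn_ord n.
rewrite NE in wN w_inv.
rewrite -[RHS](@self_inverse_kernel L w n) //.
apply: eq_bigr => -[j jL] _; rewrite !mxE /zagier_coef /=.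
(* The last column is deleted, so neither the delta at n = K nor the factor -1/2 survives. *)
rewrite (_ : (n.+1 == L.+1) = false) ?addr0 ?mulr1; last by lia.
congr (_ * _); last first.
  by rewrite subSS; congr (_%:R - 'C(_, _)%:R - 'C(_, _)%:R); lia.
case: ifPn => [_|j0]; last by rewrite (_ : j = 0%N) ?w1 //; lia.
by rewrite /w /w0; congr (a _ _ - a _ _); rewrite ?NE; lia.
Qed.

(** * From period polynomials to the identities for the form *)

Lemma typeI_coefs_form K p b u v : (0 < K)%N -> typeI_coefs K p b ->
  binary_form (2 * K - 1) (fun j => b j.+1 (2 * K - j)%N) u v =
  v * eval2 (u + v) v p.
Proof.
move=> K0 [b0 /(congr1 (eval2 u v))]; rewrite !eval2E => ->.
rewrite raddf_sum mulr_sumr big_add1 big_mkord /=.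
rewrite /binary_form (_ : (2 * K - 1).+1 = (2 * K)%N); last by lia.
apply: eq_bigr => -[j jK] _ /=; rewrite eval2Z eval2M !rmorphXn /= !eval2E.
rewrite (subn1 j.+1) (_ : (2 * K + 1 - j.+1 = 2 * K - j)%N); last by lia.
(* At j = 2K-1 one has s = 1 and s-2 truncates, but the coefficient b_{2K,1} is 0; elsewhere the
   factor v raises the exponent s-2 to s-1. *)
have [jE|jN] := eqVneq j (2 * K - 1)%N.
  have -> : b j.+1 (2 * K - j)%N = 0 by rewrite -b0; congr b; lia.
  by rewrite mulr0 !scale0r mulr0.
have -> : (2 * K - 1 - j = (2 * K - j - 2).+1)%N by lia.
by rewrite -scalerAr mulrCA exprS.
Qed.

Lemma typeII_coefs_form K p c u v : (0 < K)%N -> typeII_coefs K p c ->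
  binary_form (2 * K - 1) (fun j => c j.+1 (2 * K - j)%N) u v =
  eval2 (u + v) v (mderiv 0 p).
Proof.
move=> K0 /(congr1 (eval2 u v)).
(* In the chain rule X+Y has X-derivative 1 and Y has 0, so only the first partial derivative of [p]
   remains. *)
rewrite mderiv_subst2 mderivD !mderivXY addr0 mulr1 mulr0 addr0 !eval2E => ->.
rewrite raddf_sum big_add1 big_mkord /=.
rewrite /binary_form (_ : (2 * K - 1).+1 = (2 * K)%N); last by lia.
apply: eq_bigr => -[j jK] _ /=; rewrite eval2Z eval2M !rmorphXn /= !eval2E.
rewrite (subn1 j.+1) (_ : (2 * K + 1 - j.+1 = 2 * K - j)%N); last by lia.
by congr (_ *: (_ * _ ^+ _)); lia.
Qed.

(** Symmetry and rotation make [P] odd in each variable, hence zero on the axes. The three-term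
    relation at (u,-v) then becomes [Psplit], and splitting P(1,x) reduces both sides to P(1+x,1) -
    x P(1+x,x). *)
Lemma sym_period_relations (S : idomainType) (P : S -> S -> S) (x : S)
    (f := fun u v => v * P (u + v) v) :
    2%:R != 0 :> S ->
    (forall u v, P u v = P v u) -> (forall u v, P u v + P (- v) u = 0) ->
    (forall u v, P u v + P (u - v) u + P v (v - u) = 0) ->
  f 0 1 = f 1 0 /\ f x 1 - f 1 x = f (- x) (1 + x) - f (1 + x) (- x).
Proof.
move=> two_neq0 Psym Prot Pper.
have Podd u v : P u (- v) = - P u v.
  by rewrite Psym; apply/eqP; rewrite -addr_eq0 addrC Prot.
have P0 u : P u 0 = 0.
  apply: (mulfI two_neq0); rewrite mulr0 -[2%:R]/(1 + 1) mulrDl !mul1r.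
  by rewrite -[X in X + _]opprK -Podd oppr0 addNr.
have Psplit u v : P u v = P (u + v) u + P (u + v) v.
  have := Pper u (- v); rewrite opprK -opprD !Podd (Psym (- v)) Podd.
  by rewrite [v + u]addrC opprK -addrA addrC => /eqP; rewrite subr_eq0 => /eqP <-.
rewrite /f; split.
  rewrite add0r mul0r mul1r; have := Psplit 0 1.
  by rewrite Psym !P0 !add0r => <-.
rewrite [- x + _]addrC !addrK.
rewrite Podd (Psplit 1 x) [P 1 (1 + x)]Psym [x + 1]addrC.
by move: (P (1 + x) 1) (P (1 + x) x) => a b; ring.
Qed.

(** [Q] stands for the first partial derivative of an antisymmetric period polynomial. The
    three-term hypothesis at (0,1) and at (1,-x), simplified by parity, gives the two
    conclusions. *)
Lemma deriv_period_relations (S : comNzRingType) (Q : S -> S -> S) (x : S)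
    (f := fun u v => Q (u + v) v) :
    (forall u v, Q (- u) v = - Q u v) -> (forall u v, Q u (- v) = Q u v) ->
    (forall u v, Q u v + (Q (u - v) u - Q u (u - v)) + Q (v - u) v = 0) ->
  f 0 1 = f 1 0 /\ f x 1 - f 1 x = f (- x) (1 + x) - f (1 + x) (- x).
Proof.
move=> Qodd Qeven Qper; rewrite /f; split.
  have := Qper 0 1; rewrite !add0r addr0 subr0 Qodd Qeven.
  by move: (Q 0 1) (Q 1 0) (Q 1 1) => a b c e; rewrite -[LHS]subr0 -e; ring.
rewrite [- x + _]addrC !addrK Qeven [x + 1]addrC.
have := Qper 1 (- x); rewrite opprK Qeven -opprD Qodd Qeven [x + 1]addrC.
move: (Q 1 x) (Q (1 + x) 1) (Q 1 (1 + x)) (Q (1 + x) x) => a b c d e.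
by rewrite -[LHS]subr0 -e; ring.
Qed.

(** Differentiated antisymmetry expresses the second partial derivative [D1] through the first with
    arguments swapped. Eliminating it, the Y-derivative of the rotation relation gives oddness, its
    X-derivative evenness, and the X-derivative of the three-term relation the last identity. *)
Lemma antisym_deriv_relations w p u v : antisym_period_poly w p ->
  let Q u v := eval2 u v (mderiv 0 p) in
  [/\ Q (- u) v = - Q u v, Q u (- v) = Q u v &
    Q u v + (Q (u - v) u - Q u (u - v)) + Q (v - u) v = 0].
Proof.
case=> [[_ rot per] asym] /=.
pose D1 u v := eval2 u v (mderiv 1 p).
have D1E a b : eval2 a b (mderiv 0 p) = - D1 b a.
  move/(congr1 (mderiv 0))/(congr1 (eval2 a b)): asym.
  by rewrite mderivN mderiv_subst2 !mderivXY mulr0 mulr1 add0r !eval2E.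
have rot0 a b : eval2 a b (mderiv 0 p) + D1 (- b) a = 0.
  move/(congr1 (mderiv 0))/(congr1 (eval2 a b)): rot.
  by rewrite mderivD mderiv_subst2 mderivN !mderivXY mderiv0 oppr0 mulr0 mulr1
    add0r !eval2E rmorph0.
have rot1 a b : D1 a b - eval2 (- b) a (mderiv 0 p) = 0.
  move/(congr1 (mderiv 1))/(congr1 (eval2 a b)): rot.
  by rewrite mderivD mderiv_subst2 mderivN !mderivXY mderiv0 mulr0 mulrN1 addr0
    !eval2E rmorph0.
have per0 : eval2 u v (mderiv 0 p)
    + (eval2 (u - v) u (mderiv 0 p) + D1 (u - v) u) - D1 v (v - u) = 0.
  move/(congr1 (mderiv 0))/(congr1 (eval2 u v)): per.
  rewrite !mderivD !mderiv_subst2 !mderivB !mderivXY mderiv0 subr0 sub0r.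
  by rewrite !mulr0 !mulr1 mulrN1 add0r !eval2E rmorph0.
split.
- by rewrite (D1E u v) opprK; apply/esym/eqP; rewrite -subr_eq0 rot1.
- by rewrite (D1E u (- v)); apply/esym/eqP; rewrite -subr_eq0 opprK rot0.
- by rewrite -per0 (D1E u (u - v)) (D1E (v - u) v) opprK.
Qed.

Theorem proposition13 (K : nat) :
  ((12 <= 2 * K)%N ->
   forall (p : {mpoly rat[2]}) (b : nat -> nat -> rat),
     sym_period_poly (2 * K) p -> typeI_coefs K p b ->
     relation_row K b *m zagier_mx1 K = 0)
  /\
  ((12 <= 2 * K + 2)%N ->
   forall (p : {mpoly rat[2]}) (c : nat -> nat -> rat),
     antisym_period_poly (2 * K + 2) p -> typeII_coefs K p c ->
     relation_row K c *m zagier_mx1 K = 0).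
Proof.
split=> K12 p a.
  case=> [[_ rot per] sym] a_coefs; have K0 : (0 < K)%N by lia.
  have [|u v|u v|u v|f01 fX] :=
    @sym_period_relations _ (fun u v => eval2 u v p) 'X.
  - by rewrite -polyC_natr polyC_eq0.
  - by rewrite {1}sym !eval2E.
  - by move/(congr1 (eval2 u v)): rot; rewrite !eval2E rmorph0.
  - by move/(congr1 (eval2 u v)): per; rewrite !eval2E rmorph0.
  apply: relation_row_kernel;
    by rewrite !(typeI_coefs_form K _ _ _ _ K0 a_coefs).
move=> p_asym a_coefs; have K0 : (0 < K)%N by lia.
have [u v|u v|u v|f01 fX] :=
  @deriv_period_relations _ (fun u v => eval2 u v (mderiv 0 p)) 'X.
- by have [] := antisym_deriv_relations _ _ u v p_asym.
- by have [] := antisym_deriv_relations _ _ u v p_asym.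
- by have [] := antisym_deriv_relations _ _ u v p_asym.
apply: relation_row_kernel;
  by rewrite !(typeII_coefs_form K _ _ _ _ K0 a_coefs).
Qed.
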